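(* Let $(X,\mathcal{Q},H)$ be a $\sigma$-compact Diophantine space (i.e. a Diophantine space such that $X$ is $\sigma$-compact). If $\psi:(0,+\infty)\to(0,+\infty)$ is a bounded optimal Dirichlet function on $(X,\mathcal{Q},H)$, then $\mathrm{BA}_\psi\neq\emptyset$.
   Context: A Diophantine space is a triple $(X,\mathcal{Q},H)$, where $X$ is a complete metric space, $\mathcal{Q}$ is a dense subset of $X$, and $H:\mathcal{Q}\to(0,+\infty)$ is a function. A function $\psi:(0,+\infty)\to(0,+\infty)$ is a Dirichlet function on $(X,\mathcal{Q},H)$ if for every $x\in X$ there exist $C_x>0$ and a sequence $(r_n)_{n\ge 1}$ in $\mathcal{Q}$ such that $r_n\to x$ and $\mathrm{dist}(x,r_n)\leq C_x\,\psi(H(r_n))$ for all $n$. A Dirichlet function $\psi$ is optimal if there is no Dirichlet function $\phi:(0,+\infty)\to(0,+\infty)$ satisfying $\frac{\phi(q)}{\psi(q)}\to 0$ as $q\to+\infty$. $\mathrm{BA}_\psi$ is the set of points $x\in X$ for which there exists $\varepsilon>0$ such that $\mathrm{dist}(r,x)\geq\varepsilon\,\psi(H(r))$ for all $r\in\mathcal{Q}$. *)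

(* Defs.v *)
From HB Require Import structures.
From mathcomp Require Import all_boot all_order all_algebra.
From mathcomp Require Import all_classical all_reals all_analysis.

Set Implicit Arguments.
Unset Strict Implicit.
Unset Printing Implicit Defensive.

Import Order.TTheory GRing.Theory Num.Theory.
Import numFieldTopology.Exports numFieldNormedType.Exports.

Local Open Scope classical_set_scope.
Local Open Scope ring_scope.

(* Functions defined on a subset (H on Q, psi on the positive reals) are total
   functions whose values off that subset are never used. *)

(* Same condition as in the library's completeType, which cannot be used here
   because it also requires a distinguished point. *)
Definition complete_space (X : uniformType) : Prop :=
  forall F : set_system X, ProperFilter F -> cauchy F -> exists x : X, F --> x.

Definition sigma_compact (X : topologicalType) : Prop :=
  exists K : nat -> set X,
    (forall n, compact (K n)) /\ \bigcup_n K n = [set: X].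

Definition diophantine_space (R : realType) (X : metricType R)
    (Q : set X) (H : X -> R) : Prop :=
  [/\ complete_space X, dense Q & forall r, Q r -> 0 < H r].

(* psi maps ]0, +oo[ to ]0, +oo[ *)
Definition positive_fun (R : realType) (psi : R -> R) : Prop :=
  forall q, 0 < q -> 0 < psi q.

Definition dirichlet_fun (R : realType) (X : metricType R)
    (Q : set X) (H : X -> R) (psi : R -> R) : Prop :=
  positive_fun psi /\
  forall x : X, exists (C : R) (r : nat -> X),
    [/\ 0 < C,
        forall n, Q (r n),
        r n @[n --> \oo] --> x &
        forall n, mdist x (r n) <= C * psi (H (r n))].

Definition optimal_dirichlet_fun (R : realType) (X : metricType R)
    (Q : set X) (H : X -> R) (psi : R -> R) : Prop :=
  dirichlet_fun Q H psi /\
  ~ exists phi : R -> R,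
      dirichlet_fun Q H phi /\ phi q / psi q @[q --> +oo] --> (0 : R).

Definition BA (R : realType) (X : metricType R)
    (Q : set X) (H : X -> R) (psi : R -> R) : set X :=
  [set x | exists2 eps : R, 0 < eps &
             forall r, Q r -> eps * psi (H r) <= mdist r x].

(* Main.v *)
Require Import Defs.
From mathcomp Require Import all_boot all_order all_algebra.
From mathcomp Require Import all_classical all_reals all_analysis.
Import Order.TTheory GRing.Theory Num.Theory.
Import numFieldTopology.Exports numFieldNormedType.Exports.
Local Open Scope classical_set_scope.
Local Open Scope ring_scope.

(** If [BA Q H psi] were empty, every point would be approximated by [Q]
    arbitrarily well on the scale of [psi].  On a compact set this holds with
    bounded height: given [eps], finitely many balls of radius
    [eps * psi (H r)] about points [r] of [Q] cover the set, so heights up to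
    some [T] suffice ([compact_bounded_height]).  Exhausting [X] by compact
    sets and letting [eps] run through [1 / (n + 1)] yields thresholds [T n].

    A function [e] that tends to [0] at infinity, but so slowly that
    [e >= 1 / (n + 1)] up to [T n] ([slow_decay]), then turns these
    approximations into good ones for [phi = psi * e]: since [psi] is
    bounded, they converge to the point that they approximate.  Hence [phi] is
    a Dirichlet function negligible with respect to [psi], against the
    optimality of [psi]. *)

(** Take [e q = 1 / (N q + 1)], where [N q] is the least [n] with [q <= S n]
    for some increasing unbounded [S >= T]; [N] tends to infinity with [q]
    because [N q > k] as soon as [q > S k]. *)
Lemma slow_decay (R : realType) (T : nat -> R) :
  exists e : R -> R, [/\ forall q, 0 < e q,
    e q @[q --> +oo] --> (0 : R) &
    forall n q, q <= T n -> harmonic n <= e q].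
Proof.
(* The summands [+ 1] make [S] unbounded even if [T] is bounded. *)
pose S n : R := \sum_(i < n.+1) (`|T i| + 1).
have S_ge n : T n <= S n.
  rewrite /S big_ord_recr /= (le_trans (ler_norm _))// -[leLHS]add0r.
  by rewrite lerD ?lerDl// sumr_ge0// => i _; rewrite addr_ge0.
have S_le k n : (k <= n)%N -> S k <= S n.
  apply: (homo_leq le_refl le_trans) => i.
  by rewrite /S [leRHS]big_ord_recr /= lerDl addr_ge0.
have S_unbounded q : exists n, q <= S n.
  exists (Num.bound `|q|); apply: (le_trans (ler_norm q)).
  apply: (le_trans (ltW (archi_boundP (normr_ge0 q)))).
  rewrite /S (@le_trans _ _ (\sum_(i < (Num.bound `|q|).+1) (1 : R)))//.
    by rewrite sumr_const card_ord ler_nat.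
  by apply: ler_sum => i _; rewrite lerDr.
pose N q := ex_minn (S_unbounded q).
have N_le n q : q <= S n -> (N q <= n)%N.
  by rewrite /N; case: ex_minnP => m _ mmin /mmin.
have N_gt k q : S k < q -> (k < N q)%N.
  rewrite ltnNge; apply: contraTN => /S_le; rewrite -leNgt; apply: le_trans.
  by rewrite /N; case: ex_minnP.
have harmonic_le i j : (i <= j)%N -> (harmonic j : R) <= harmonic i.
  by move=> ij; rewrite /harmonic /= lef_pV2 ?posrE ?ltr0n// ler_nat ltnS.
exists (fun q => harmonic (N q)); split.
- by move=> q; exact: harmonic_gt0.
- apply/cvgr0Pnorm_lt => eps eps0.
  have /cvgr0Pnorm_lt/(_ _ eps0)[k _ kP] := @cvg_harmonic R.
  near=> q; apply: kP => /=; apply/ltnW/N_gt.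
  by near: q; apply: nbhs_pinfty_gt; rewrite num_real.
- by move=> n q qT; apply/harmonic_le/N_le/(le_trans qT).
Unshelve. all: by end_near. Qed.

(** Compactness is used through filters: the assumption holds near each point
    for all large heights, hence on [K] for all large heights. *)
Lemma compact_bounded_height (R : realType) (X : metricType R)
    (Q : set X) (H rho : X -> R) (K : set X) :
  compact K ->
  (forall x, K x -> exists2 r, Q r & mdist r x < rho r) ->
  exists T : R, forall x, K x ->
    exists r, [/\ Q r, H r <= T & mdist r x < rho r].
Proof.
move=> /compact_near_coveringP cK Kcover.
suff /pinfty_ex_gt0[T _] : \forall T \near +oo,
    K `<=` [set x | exists r, [/\ Q r, H r <= T & mdist r x < rho r]].
  by exists T.
apply: cK => x /Kcover[r Qr rx].
have ballx : nbhs x [set y | mdist r y < rho r].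
  apply/metricType_numDomainType.nbhs_mdistP.
  exists (rho r - mdist r x); first by rewrite /= subr_gt0.
  by move=> y /=; rewrite ltrBrDl; apply/le_lt_trans/metric_triangle.
exists ([set y | mdist r y < rho r], [set T | H r <= T]).
  by split=> //=; apply: nbhs_pinfty_ge; rewrite num_real.
by move=> [y T] [/= ry rT]; exists r.
Qed.

(** Under [BA_psi = set0], heights bounded by [T n] give approximations of
    quality [1 / (n + 1)] on the [n]-th set of an exhaustion of [X]; a given
    point belongs to all but finitely many of these sets. *)
Lemma uniform_thresholds (R : realType) (X : metricType R)
    (Q : set X) (H : X -> R) (psi : R -> R) :
  sigma_compact X -> BA Q H psi = set0 ->
  exists T : nat -> R, forall x, \forall n \near \oo,
    exists r, [/\ Q r, H r <= T n & mdist r x < harmonic n * psi (H r)].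
Proof.
move=> [K [cK KT]] BA0.
have appr n x : exists2 r, Q r & mdist r x < harmonic n * psi (H r).
  apply: contrapT => nex; suff : BA Q H psi x by rewrite BA0.
  exists (harmonic n); first exact: harmonic_gt0.
  by move=> r Qr; rewrite leNgt; apply/negP => rx; apply: nex; exists r.
have thr n : exists T : R, forall x, (\big[setU/set0]_(i < n.+1) K i) x ->
    exists r, [/\ Q r, H r <= T & mdist r x < harmonic n * psi (H r)].
  apply: (@compact_bounded_height _ _ _ _ (fun r => harmonic n * psi (H r))).
    by apply: bigsetU_compact.
  by move=> x _; exact: appr.
have [T TP] := choice thr; exists T => x.
have [m _ Kmx] : (\bigcup_n K n) x by rewrite KT.
exists m => // n /= mn; apply: TP; rewrite -bigcup_mkord.
by exists m.
Qed.

Theorem proposition2p7 (R : realType) (X : metricType R)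
    (Q : set X) (H : X -> R) (psi : R -> R)
    (XQH : diophantine_space Q H)
    (scX : sigma_compact X)
    (psi_gt0 : positive_fun psi)
    (psi_bounded : [bounded psi q | q in `]0, +oo[%classic])
    (psi_optimal : optimal_dirichlet_fun Q H psi) :
  BA Q H psi !=set0.
Proof.
have [_ _ H_gt0] := XQH; have [_ noptimal] := psi_optimal.
apply/set0P/eqP => /(uniform_thresholds _ _ _ _ _ scX)[T TP].
have [e [e_gt0 e_cvg e_ge]] := slow_decay _ T.
have /pinfty_ex_gt0[M M_gt0 psi_le] := psi_bounded.
apply: noptimal; exists (fun q => psi q * e q); split; last first.
  apply: cvg_trans e_cvg; apply: near_eq_cvg; near=> q.
  by rewrite mulrAC divff ?mul1r// gt_eqF// psi_gt0.
split=> [q q0|x]; first by rewrite mulr_gt0// psi_gt0.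
have [m _ mP] := TP x.
(* The thresholds serve [x] from rank [m] on only, so the sequence starts at
   that rank. *)
have /choice[r rP] n : exists r, [/\ Q r, H r <= T (n + m)%N &
    mdist r x < harmonic (n + m)%N * psi (H r)].
  by apply: mP; rewrite /= leq_addl.
exists 1, r; split => // [n|| n].
- by have [] := rP n.
- apply/metricType_numDomainType.cvgrPdist_lt => eps eps0.
  have epsM : 0 < eps / M by rewrite divr_gt0.
  have /cvgr0Pnorm_lt/(_ _ epsM)[k _ kP] := @cvg_harmonic R.
  exists k => // n /= kn; have [Qr _ rx] := rP n.
  rewrite metric_sym (lt_trans rx)//.
  have /kP : (k <= n + m)%N by rewrite (leq_trans kn)// leq_addr.
  rewrite /= ger0_norm ?harmonic_ge0// ltr_pdivlMr// => /le_lt_trans -> //.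
  rewrite ler_wpM2l ?harmonic_ge0// (le_trans (ler_norm _))//.
  by apply: psi_le; rewrite /= in_itv /= andbT H_gt0.
- have [Qr rT rx] := rP n; rewrite metric_sym mul1r (le_trans (ltW rx))// mulrC.
  by rewrite ler_wpM2l ?e_ge// ltW// psi_gt0// H_gt0.
Unshelve. all: by end_near. Qed.
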